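(* There are classes of structures $\mathfrak{C}_1,\mathfrak{C}_2$ and $\mathfrak{D}_1,\mathfrak{D}_2$ such that: (1) $\mathfrak{C}_1$ is u.c.t. reducible to $\mathfrak{D}_1$ but $\mathfrak{C}_1$ is not u.p.e.t. reducible to $\mathfrak{D}_1$; (2) $\mathfrak{C}_2$ is u.p.e.t. reducible to $\mathfrak{D}_2$ but $\mathfrak{C}_2$ is not u.c.t. reducible to $\mathfrak{D}_2$.
   Context: Structures: all structures are countable with universe $\omega$, in a relational language $(R_i)_{i\in\omega}$ where $R_i$ has arity $a_i$ and $i\mapsto a_i$ is computable. A class of structures (in a fixed language) is viewed as a category whose morphisms are the isomorphisms between its members; $Hom(\mathcal{A},\mathcal{B})$ is the set of isomorphisms from $\mathcal{A}$ to $\mathcal{B}$. Different classes may have different languages. A functor maps structures to structures and isomorphisms $f:\mathcal{A}\to\mathcal{B}$ to isomorphisms $F(f):F(\mathcal{A})\to F(\mathcal{B})$, preserving composition and identities. Coding: tuples of natural numbers are coded by numbers via a fixed computable coding $\langle\cdot\rangle$, and $\oplus$ and $\bigoplus_{i\in\omega}$ denote the usual effective joins of sets. $Graph(f)=\{\langle x,y\rangle: f(x)=y\}$. The atomic diagram of $\mathcal{A}$ is $D(\mathcal{A})=\bigoplus_{i\in\omega}R_i^{\mathcal{A}}\oplus\bigoplus_{i\in\omega}\neg R_i^{\mathcal{A}}$. The positive diagram of $\mathcal{A}$ is $P(\mathcal{A})={=}\oplus{\neq}\oplus\bigoplus_{i\in\omega}R_i^{\mathcal{A}}$, where $=$ and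 $\neq$ are equality and inequality on $\omega$. An enumeration operator $\Psi$ is a c.e. set of pairs $(E,x)$ with $E$ (a code of) a finite set, and $\Psi^X=\{x:\exists E\subseteq X\ (E,x)\in\Psi\}$. For a Turing operator $\Phi$ and a set $Y$, $\Phi^X=Y$ means that $\Phi$ computes the characteristic function of $Y$ from the oracle $X$; for a function $g$, $\Phi^X=g$ means $\Phi$ computes $g$ from $X$. A functor $F:\mathfrak{C}\to\mathfrak{D}$ is computable if there are Turing operators $\Phi,\Phi_*$ such that for all $\mathcal{A},\mathcal{B}\in\mathfrak{C}$: (1) $\Phi^{D(\mathcal{A})}=D(F(\mathcal{A}))$; (2) for all $f\in Hom(\mathcal{A},\mathcal{B})$, $\Phi_*^{D(\mathcal{A})\oplus Graph(f)\oplus D(\mathcal{B})}=F(f)$. It is positive enumerable if there are enumeration operators $\Psi,\Psi_*$ such that for all $\mathcal{A},\mathcal{B}\in\mathfrak{C}$: (1) $\Psi^{P(\mathcal{A})}=P(F(\mathcal{A}))$; (2) for all $f\in Hom(\mathcal{A},\mathcal{B})$, $\Psi_*^{P(\mathcal{A})\oplus Graph(f)\oplus P(\mathcal{B})}=Graph(F(f))$. A functor $F:\mathfrak{C}\to\mathfrak{D}$ is effectively isomorphic to $G:\mathfrak{C}\to\mathfrak{D}$ via a Turing functional $\Lambda$ if for every $\mathcal{A}\in\mathfrak{C}$, $\Lambda^{\mathcal{A}}$ (computed with oracle $D(\mathcal{A})$) is an isomorphism $F(\mathcal{A})\to G(\mathcal{A})$, and for every $h\in Hom(\mathcal{A},\mathcal{B})$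 in $\mathfrak{C}$, $\Lambda^{\mathcal{B}}\circ F(h)=G(h)\circ\Lambda^{\mathcal{A}}$. Functors $F:\mathfrak{C}\to\mathfrak{D}$, $G:\mathfrak{D}\to\mathfrak{C}$ are pseudo inverses if there are Turing functionals $\Lambda_{\mathfrak{C}},\Lambda_{\mathfrak{D}}$ such that $Id_{\mathfrak{C}}$ is effectively isomorphic to $G\circ F$ via $\Lambda_{\mathfrak{C}}$, $Id_{\mathfrak{D}}$ is effectively isomorphic to $F\circ G$ via $\Lambda_{\mathfrak{D}}$, and for all $\mathcal{A}\in\mathfrak{C}$, $\mathcal{B}\in\mathfrak{D}$: $\Lambda_{\mathfrak{D}}^{F(\mathcal{A})}=F(\Lambda_{\mathfrak{C}}^{\mathcal{A}}):F(\mathcal{A})\to F(G(F(\mathcal{A})))$ and $\Lambda_{\mathfrak{C}}^{G(\mathcal{B})}=G(\Lambda_{\mathfrak{D}}^{\mathcal{B}}):G(\mathcal{B})\to G(F(G(\mathcal{B})))$. A class $\mathfrak{C}$ is uniformly computably transformably reducible (u.c.t. reducible) to $\mathfrak{D}$ if there are a subclass $\mathfrak{D}'\subseteq\mathfrak{D}$ and computable functors $F:\mathfrak{C}\to\mathfrak{D}'$ and $G:\mathfrak{D}'\to\mathfrak{C}$ that are pseudo inverses. It is uniformly positive enumerably transformably reducible (u.p.e.t. reducible) to $\mathfrak{D}$ if there are a subclass $\mathfrak{D}'\subseteq\mathfrak{D}$ and positive enumerable functors $F:\mathfrak{C}\to\mathfrak{D}'$ and $G:\mathfrak{D}'\to\mathfrak{C}$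 that are pseudo inverses. *)

(* Defs.v *)
From mathcomp Require Import all_boot.
From Stdlib Require Cantor.

Set Implicit Arguments.
Unset Strict Implicit.
Unset Printing Implicit Defensive.

(** * Coding *)

Definition pair_code (x y : nat) : nat := Cantor.to_nat (x, y).

(* A bijective coding of finite sequences by numbers; it codes both tuples
   and (by listing the elements, in any order) finite sets. *)
Fixpoint seq_code (s : seq nat) : nat :=
  if s is x :: s' then (pair_code x (seq_code s')).+1 else 0.

Definition join (X Y : nat -> Prop) : nat -> Prop :=
  fun n => if odd n then Y n./2 else X n./2.

Definition bigjoin (X : nat -> nat -> Prop) : nat -> Prop :=
  fun n => exists i x, n = pair_code i x /\ X i x.

Definition graph (f : nat -> nat) : nat -> Prop :=
  fun n => exists x, n = pair_code x (f x).

(** * Turing operators and enumeration operators *)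

(* Oracle programs for partial recursive functions of one argument; several
   arguments are passed as Cantor pairs. *)
Inductive program : Type :=
  | Zero
  | Succ
  | Fst
  | Snd
  | Pair of program & program
  | Comp of program & program
  | Prec of program & program
  | Mu of program
  | Query.

(* [eval X p x y]: with oracle X, program p halts on input x with output y.
   [Prec p q] on (a, n) iterates (a, (k, v)) |-> q for k < n, starting from
   p(a); [Mu p] on a is the least m with p(a, m) = 0, all earlier values of p
   being defined and nonzero. *)
Fixpoint eval (X : nat -> Prop) (p : program) (x y : nat) : Prop :=
  match p with
  | Zero => y = 0
  | Succ => y = x.+1
  | Fst => y = (Cantor.of_nat x).1
  | Snd => y = (Cantor.of_nat x).2
  | Pair p q => exists a b, [/\ eval X p x a, eval X q x b & y = pair_code a b]
  | Comp p q => exists2 z, eval X q x z & eval X p z y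
  | Prec p q =>
      let: (a, n) := Cantor.of_nat x in
      exists v : nat -> nat,
        [/\ eval X p a (v 0),
            forall k, k < n ->
              eval X q (pair_code a (pair_code k (v k))) (v k.+1)
          & y = v n]
  | Mu p =>
      eval X p (pair_code x y) 0 /\
      (forall k, k < y -> exists v, eval X p (pair_code x k) v.+1)
  | Query => (X x /\ y = 1) \/ (~ X x /\ y = 0)
  end.

Lemma eval_functional (X : nat -> Prop) (p : program) (x y z : nat) :
  eval X p x y -> eval X p x z -> y = z.
Proof.
elim: p x y z => [||||p IHp q IHq|p IHp q IHq|p IHp q IHq|p IHp|] x y z /=.
- by move=> -> ->.
- by move=> -> ->.
- by move=> -> ->.
- by move=> -> ->.
- move=> [a [b [pa qb ->]]] [a' [b' [pa' qb' ->]]].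
  by rewrite (IHp _ _ _ pa pa') (IHq _ _ _ qb qb').
- move=> [a qa pa] [b qb pb]; rewrite (IHq _ _ _ qa qb) in pa.
  exact: IHp pa pb.
- case: (Cantor.of_nat x) => a n [v [v0 vS ->]] [w [w0 wS ->]].
  elim: n vS wS => [|n IHn] vS wS; first exact: IHp v0 w0.
  have vw : v n = w n by apply: IHn => k kn; [apply: vS|apply: wS]; exact: ltnW.
  have := wS n (ltnSn n); rewrite -vw => wn.
  exact: IHq (vS n (ltnSn n)) wn.
- move=> [py yP] [pz zP]; case: (ltngtP y z) => // [yz|zy].
  + by have [v pv] := zP _ yz; have := IHp _ _ _ py pv.
  + by have [v pv] := yP _ zy; have := IHp _ _ _ pz pv.
- by move=> [[Xx ->]|[Xx ->]] [[Yx ->]|[Yx ->]].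
Qed.

Definition computes_fun (p : program) (X : nat -> Prop) (g : nat -> nat) : Prop :=
  forall x, eval X p x (g x).

Definition computes_set (p : program) (X Y : nat -> Prop) : Prop :=
  forall x, (Y x -> eval X p x 1) /\ (~ Y x -> eval X p x 0).

Definition no_oracle : nat -> Prop := fun=> False.

Definition computable (g : nat -> nat) : Prop :=
  exists p, computes_fun p no_oracle g.

Definition ce (W : nat -> Prop) : Prop :=
  exists p, forall x, W x <-> exists y, eval no_oracle p x y.

(* For a set Psi of codes of pairs (E, x), the set Psi^X. *)
Definition enum_apply (Psi X : nat -> Prop) : nat -> Prop :=
  fun x => exists E : seq nat,
    (forall n, n \in E -> X n) /\ Psi (pair_code (seq_code E) x).

Definition enumerates (Psi X Y : nat -> Prop) : Prop :=
  forall x, enum_apply Psi X x <-> Y x.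

(** * Structures *)

Record language : Type := Language {
  arity : nat -> nat;
  arity_computable : computable arity
}.

Definition structure (L : language) : Type :=
  forall i : nat, (arity L i).-tuple nat -> Prop.

Definition rel_codes (L : language) (A : structure L) (i : nat) : nat -> Prop :=
  fun n => exists t : (arity L i).-tuple nat, n = seq_code t /\ A i t.

Definition neg_rel_codes (L : language) (A : structure L) (i : nat) : nat -> Prop :=
  fun n => exists t : (arity L i).-tuple nat, n = seq_code t /\ ~ A i t.

Definition atomic_diagram (L : language) (A : structure L) : nat -> Prop :=
  join (bigjoin (rel_codes A)) (bigjoin (neg_rel_codes A)).

Definition eq_codes : nat -> Prop :=
  fun n => exists x y, n = pair_code x y /\ x = y.

Definition neq_codes : nat -> Prop :=
  fun n => exists x y, n = pair_code x y /\ x <> y.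

Definition positive_diagram (L : language) (A : structure L) : nat -> Prop :=
  join eq_codes (join neq_codes (bigjoin (rel_codes A))).

Definition isomorphism (L : language) (A B : structure L) (f : nat -> nat) : Prop :=
  bijective f /\
  forall i (t : (arity L i).-tuple nat), A i t <-> B i (map_tuple f t).

(** * Classes of structures as categories *)

Definition class (L : language) : Type := structure L -> Prop.

Definition subclass (L : language) (C D : class L) : Prop :=
  forall A, C A -> D A.

Definition obj (L : language) (C : class L) : Type := {A : structure L | C A}.

(* Two morphisms are equal exactly when the underlying functions are, by proof
   irrelevance. *)
Definition Hom (L : language) (C : class L) (A B : obj C) : Type :=
  {f : nat -> nat | isomorphism (sval A) (sval B) f}.

Lemma isomorphism_id (L : language) (A : structure L) : isomorphism A A id.
Proof.
split; first by exists id.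
move=> i t; have -> // : map_tuple id t = t.
by apply: val_inj; rewrite /= map_id.
Qed.

Lemma isomorphism_comp (L : language) (A B E : structure L) (g f : nat -> nat) :
  isomorphism B E g -> isomorphism A B f -> isomorphism A E (g \o f).
Proof.
move=> [gb gP] [fb fP]; split; first exact: bij_comp.
move=> i t; have -> : map_tuple (g \o f) t = map_tuple g (map_tuple f t).
  by apply: val_inj; rewrite /= map_comp.
by split=> [/fP/gP|/gP/fP].
Qed.

Definition hom_id (L : language) (C : class L) (A : obj C) : Hom A A :=
  exist _ id (isomorphism_id (sval A)).

Definition hom_comp (L : language) (C : class L) (A B E : obj C)
    (g : Hom B E) (f : Hom A B) : Hom A E :=
  exist _ (sval g \o sval f) (isomorphism_comp (svalP g) (svalP f)).

Record functor (L M : language) (C : class L) (D : class M) : Type := Functor {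
  fobj : obj C -> obj D;
  fmor : forall A B : obj C, Hom A B -> Hom (fobj A) (fobj B);
  fmor_id : forall A : obj C, fmor (hom_id A) = hom_id (fobj A);
  fmor_comp : forall (A B E : obj C) (g : Hom B E) (f : Hom A B),
    fmor (hom_comp g f) = hom_comp (fmor g) (fmor f)
}.

Definition id_functor (L : language) (C : class L) : functor C C :=
  @Functor L L C C (fun A => A) (fun A B f => f) (fun A => erefl)
    (fun A B E g f => erefl).

Section CompFunctor.
Variables (L M N : language) (C : class L) (D : class M) (E : class N).
Variables (G : functor D E) (F : functor C D).

Let GF_mor (A B : obj C) (f : Hom A B) :
  Hom (fobj G (fobj F A)) (fobj G (fobj F B)) := fmor G (fmor F f).

Lemma comp_functor_id (A : obj C) :
  GF_mor (hom_id A) = hom_id (fobj G (fobj F A)).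
Proof. by rewrite /GF_mor !fmor_id. Qed.

Lemma comp_functor_comp (A B K : obj C) (g : Hom B K) (f : Hom A B) :
  GF_mor (hom_comp g f) = hom_comp (GF_mor g) (GF_mor f).
Proof. by rewrite /GF_mor !fmor_comp. Qed.

Definition comp_functor : functor C E :=
  @Functor L N C E (fun A => fobj G (fobj F A))
    (fun A B f => fmor G (fmor F f)) comp_functor_id comp_functor_comp.

End CompFunctor.

Definition computable_functor (L M : language) (C : class L) (D : class M)
    (F : functor C D) : Prop :=
  exists Phi Phi_mor : program,
    (forall A : obj C,
       computes_set Phi (atomic_diagram (sval A))
                        (atomic_diagram (sval (fobj F A)))) /\
    (forall (A B : obj C) (f : Hom A B),
       computes_fun Phi_mor
         (join (atomic_diagram (sval A))
               (join (graph (sval f)) (atomic_diagram (sval B))))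
         (sval (fmor F f))).

Definition positive_enumerable_functor (L M : language) (C : class L)
    (D : class M) (F : functor C D) : Prop :=
  exists Psi Psi_mor : nat -> Prop,
    [/\ ce Psi, ce Psi_mor,
        (forall A : obj C,
           enumerates Psi (positive_diagram (sval A))
                          (positive_diagram (sval (fobj F A))))
      & (forall (A B : obj C) (f : Hom A B),
           enumerates Psi_mor
             (join (positive_diagram (sval A))
                   (join (graph (sval f)) (positive_diagram (sval B))))
             (graph (sval (fmor F f))))].

(* [lam] is the family of isomorphisms computed by the functional [Lambda];
   it is determined by [Lambda] (see [eval_functional]). *)
Definition effectively_isomorphic_via (L M : language) (C : class L)
    (D : class M) (F G : functor C D) (Lambda : program)
    (lam : forall A : obj C, Hom (fobj F A) (fobj G A)) : Prop :=
  (forall A : obj C,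
     computes_fun Lambda (atomic_diagram (sval A)) (sval (lam A))) /\
  (forall (A B : obj C) (h : Hom A B),
     hom_comp (lam B) (fmor F h) = hom_comp (fmor G h) (lam A)).

Definition pseudo_inverses (L M : language) (C : class L) (D : class M)
    (F : functor C D) (G : functor D C) : Prop :=
  exists (LambdaC LambdaD : program)
         (lamC : forall A : obj C, Hom A (fobj G (fobj F A)))
         (lamD : forall B : obj D, Hom B (fobj F (fobj G B))),
    [/\ effectively_isomorphic_via
          (F := id_functor C) (G := comp_functor G F) LambdaC lamC,
        effectively_isomorphic_via
          (F := id_functor D) (G := comp_functor F G) LambdaD lamD,
        (forall A : obj C, lamD (fobj F A) = fmor F (lamC A))
      & (forall B : obj D, lamC (fobj G B) = fmor G (lamD B))].

Definition uct_reducible (L M : language) (C : class L) (D : class M) : Prop :=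
  exists D' : class M, subclass D' D /\
    exists (F : functor C D') (G : functor D' C),
      [/\ computable_functor F, computable_functor G & pseudo_inverses F G].

Definition upet_reducible (L M : language) (C : class L) (D : class M) : Prop :=
  exists D' : class M, subclass D' D /\
    exists (F : functor C D') (G : functor D' C),
      [/\ positive_enumerable_functor F, positive_enumerable_functor G
        & pseudo_inverses F G].

(* Main.v *)
From mathcomp Require Import all_boot.
From Stdlib Require Cantor.
From Stdlib Require Import ClassicalEpsilon.
Require Import Defs.

Set Implicit Arguments.
Unset Strict Implicit.
Unset Printing Implicit Defensive.

(** The separations come from topology rather than from recursion theory.  In
    a language with nullary relation symbols only, a structure is a set of
    natural numbers and two structures are isomorphic only if they are the same
    set; so a family of sets is a class in which a reduction can do nothing but
    send the sets of one family injectively to sets of another one, and the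
    morphisms can be left unchanged.

    (1) An enumeration operator is monotone in its oracle, so a positive
    enumerable functor between such classes preserves inclusion
    ([upet_reducible_monotone]).  Hence the chain consisting of {} and {0} has
    no such reduction to the antichain consisting of {1} and {0}.  Each of these
    four sets is computable and one query tells the members of a family apart,
    so Turing operators translate both ways.

    (2) A Turing operator reads a finite part of its oracle ([eval_use]), so a
    computable functor between such classes is continuous for the topology of
    Cantor space ([uct_reducible_continuous]).  In the family of {} and all
    {m+1}, the empty set is the limit of the others; in the family of {} and all
    {0, m+1} every member is isolated ([discrete_isolated]).  A continuous map
    from the first family to the second is constant near {}, so it is not
    injective.  From positive information the two families are
    interchangeable: 0 is put in as soon as some m+1 has been enumerated, and is
    omitted on the way back. *)

(** * Programs computing a function uniformly in an oracle *)

Definition uniformly_computable (J : Type) (O : J -> nat -> Prop)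
    (G : J -> nat -> nat) : Prop :=
  exists p, forall j, computes_fun p (O j) (G j).

Lemma pair_codeK (x y : nat) : Cantor.of_nat (pair_code x y) = (x, y).
Proof. exact: Cantor.cancel_of_to. Qed.

Lemma pair_code_of_nat (n : nat) :
  pair_code (Cantor.of_nat n).1 (Cantor.of_nat n).2 = n.
Proof. by rewrite /pair_code -surjective_pairing Cantor.cancel_to_of. Qed.

Section UniformlyComputable.
Variables (J : Type) (O : J -> nat -> Prop).

Local Notation uc := (uniformly_computable O).

Lemma uc_ext (G H : J -> nat -> nat) :
  (forall j n, G j n = H j n) -> uc G -> uc H.
Proof. by move=> GH [p pP]; exists p => j n; rewrite -GH; apply: pP. Qed.

Lemma uc_id : uc (fun _ n => n).
Proof.
exists (Pair Fst Snd) => j n /=.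
by exists (Cantor.of_nat n).1, (Cantor.of_nat n).2; split=> //; rewrite pair_code_of_nat.
Qed.

Lemma uc_comp (G H : J -> nat -> nat) :
  uc G -> uc H -> uc (fun j n => G j (H j n)).
Proof.
by move=> [p pP] [q qP]; exists (Comp p q) => j n /=; exists (H j n); [apply: qP|apply: pP].
Qed.

Lemma uc_pair (G H : J -> nat -> nat) :
  uc G -> uc H -> uc (fun j n => pair_code (G j n) (H j n)).
Proof.
move=> [p pP] [q qP]; exists (Pair p q) => j n /=.
by exists (G j n), (H j n); split; [apply: pP|apply: qP|].
Qed.

Lemma uc_fst (G : J -> nat -> nat) :
  uc G -> uc (fun j n => (Cantor.of_nat (G j n)).1).
Proof. by apply: (uc_comp (G := fun _ n => (Cantor.of_nat n).1)); exists Fst. Qed.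

Lemma uc_snd (G : J -> nat -> nat) :
  uc G -> uc (fun j n => (Cantor.of_nat (G j n)).2).
Proof. by apply: (uc_comp (G := fun _ n => (Cantor.of_nat n).2)); exists Snd. Qed.

Lemma uc_succ (G : J -> nat -> nat) : uc G -> uc (fun j n => (G j n).+1).
Proof. by apply: (uc_comp (G := fun _ n => n.+1)); exists Succ. Qed.

Lemma uc_const (c : nat) : uc (fun _ _ => c).
Proof.
elim: c => [|c IHc]; first by exists Zero.
exact: uc_succ IHc.
Qed.

(** The step function sees the whole input [n], so that parameters of the
    recursion need no separate coding. *)
Lemma uc_iteri (B C : J -> nat -> nat) (S : J -> nat -> nat -> nat -> nat) :
  uc B -> uc C ->
  uc (fun j z => let: (n, w) := Cantor.of_nat z in
                 S j n (Cantor.of_nat w).1 (Cantor.of_nat w).2) ->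
  uc (fun j n => iteri (C j n) (S j n) (B j n)).
Proof.
move=> [b bP] ucC [s sP].
have [r rP] : uc (fun _ n => n) := uc_id.
have [c cP] := ucC.
exists (Comp (Prec b s) (Pair r c)) => j n /=.
exists (pair_code n (C j n)).
  by exists n, (C j n); split; [apply: rP|apply: cP|].
rewrite pair_codeK; exists (fun k => iteri k (S j n) (B j n)); split=> //=.
  exact: bP.
by move=> k _; have := sP j (pair_code n (pair_code k (iteri k (S j n) (B j n))));
  rewrite !pair_codeK.
Qed.

Lemma uc_input (G : J -> nat -> nat) :
  uc G -> uc (fun j z => G j (Cantor.of_nat z).1).
Proof. by move=> ucG; apply: uc_comp ucG _; apply: uc_fst uc_id. Qed.

Lemma uc_if (C : J -> nat -> bool) (G H : J -> nat -> nat) :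
  uc (fun j n => C j n) -> uc G -> uc H ->
  uc (fun j n => if C j n then G j n else H j n).
Proof.
move=> ucC ucG ucH.
have := @uc_iteri H (fun j n => C j n) (fun j n _ _ => G j n) ucH ucC.
move=> /(_ _) IF; apply: uc_ext (IF _) => [j n|]; first by case: (C j n).
by apply: uc_ext (uc_input ucG) => j z; case: (Cantor.of_nat z).
Qed.

Lemma uc_pred (G : J -> nat -> nat) : uc G -> uc (fun j n => (G j n).-1).
Proof.
move=> ucG.
apply: uc_ext (@uc_iteri (fun _ _ => 0) G (fun _ _ k _ => k) _ ucG _).
- by move=> j n; case: (G j n).
- exact: uc_const.
apply: uc_ext (uc_fst (uc_snd uc_id)) => j z.
by case: (Cantor.of_nat z).
Qed.

Lemma uc_iter (S : nat -> nat) (B C : J -> nat -> nat) :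
  uc (fun _ n => S n) -> uc B -> uc C ->
  uc (fun j n => iter (C j n) S (B j n)).
Proof.
move=> ucS ucB ucC.
apply: uc_ext (@uc_iteri B C (fun _ _ _ v => S v) ucB ucC _).
  by move=> j n; elim: (C j n) => //= k ->.
apply: uc_ext (uc_comp ucS (uc_snd (uc_snd uc_id))) => j z.
by case: (Cantor.of_nat z).
Qed.

Lemma uc_add (G H : J -> nat -> nat) :
  uc G -> uc H -> uc (fun j n => G j n + H j n).
Proof.
move=> ucG ucH; apply: uc_ext (uc_iter (uc_succ uc_id) ucG ucH) => j n.
by rewrite iter_succn.
Qed.

Lemma uc_double (G : J -> nat -> nat) : uc G -> uc (fun j n => (G j n).*2).
Proof.
by move=> ucG; apply: uc_ext (uc_add ucG ucG) => j n; rewrite addnn.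
Qed.

Lemma uc_sub (G H : J -> nat -> nat) :
  uc G -> uc H -> uc (fun j n => G j n - H j n).
Proof.
move=> ucG ucH; apply: uc_ext (uc_iter (uc_pred uc_id) ucG ucH) => j n.
by elim: (H j n) => [|k IHk]; rewrite ?subn0 // iterS IHk subnS.
Qed.

Lemma uc_neg (C : J -> nat -> bool) :
  uc (fun j n => C j n) -> uc (fun j n => ~~ C j n).
Proof.
move=> ucC; apply: uc_ext (uc_sub (uc_const 1) ucC) => j n.
by case: (C j n).
Qed.

Lemma uc_and (C D : J -> nat -> bool) :
  uc (fun j n => C j n) -> uc (fun j n => D j n) ->
  uc (fun j n => C j n && D j n).
Proof.
move=> ucC ucD; apply: uc_ext (uc_if ucC ucD (uc_const 0)) => j n.
by case: (C j n).
Qed.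

Lemma uc_xor (C D : J -> nat -> bool) :
  uc (fun j n => C j n) -> uc (fun j n => D j n) ->
  uc (fun j n => C j n (+) D j n).
Proof.
move=> ucC ucD; apply: uc_ext (uc_if ucC (uc_neg ucD) ucD) => j n.
by case: (C j n).
Qed.

Lemma uc_eq (G H : J -> nat -> nat) :
  uc G -> uc H -> uc (fun j n => G j n == H j n).
Proof.
have uc_le (G' H' : J -> nat -> nat) :
  uc G' -> uc H' -> uc (fun j n => G' j n <= H' j n).
  move=> ucG ucH.
  apply: uc_ext (uc_sub (uc_const 1) (uc_sub ucG ucH)) => j n.
  by rewrite -subn_eq0; case: (G' j n - H' j n).
move=> ucG ucH; apply: uc_ext (uc_and (uc_le _ _ ucG ucH) (uc_le _ _ ucH ucG)).
by move=> j n; rewrite eqn_leq.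
Qed.

Lemma uc_odd (G : J -> nat -> nat) : uc G -> uc (fun j n => odd (G j n)).
Proof.
move=> ucG.
apply: uc_ext (uc_iter (uc_sub (uc_const 1) uc_id) (uc_const 0) ucG) => j n.
by elim: (G j n) => //= k ->; case: (odd k).
Qed.

Lemma uc_half (G : J -> nat -> nat) : uc G -> uc (fun j n => (G j n)./2).
Proof.
move=> ucG.
apply: uc_ext (@uc_iteri (fun _ _ => 0) G (fun _ _ k v => odd k + v) _ ucG _).
- by move=> j n; elim: (G j n) => //= k ->; rewrite uphalf_half.
- exact: uc_const.
apply: uc_ext (uc_add (uc_odd (uc_fst (uc_snd uc_id))) (uc_snd (uc_snd uc_id))).
by move=> j z; case: (Cantor.of_nat z).
Qed.

Lemma uc_query (C : J -> nat -> bool) (H : J -> nat -> nat) :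
  uc H -> (forall j n, O j (H j n) <-> C j n) -> uc (fun j n => C j n).
Proof.
move=> [p pP] OC; exists (Comp Query p) => j n /=; exists (H j n); first exact: pP.
rewrite /=; case Cn: (C j n); first by left; split=> //; apply/OC.
by right; split=> // /OC; rewrite Cn.
Qed.

Lemma uc_mu (C : J -> nat -> bool) (G : J -> nat -> nat) :
  uc (fun j n => C j n) ->
  (forall j x y, C j (pair_code x y) = (y == G j x)) ->
  uc G.
Proof.
move=> /uc_neg [p pP] CG; exists (Mu p) => j x /=; split.
  by have := pP j (pair_code x (G j x)); rewrite CG eqxx.
move=> k kG; exists 0; have := pP j (pair_code x k).
by rewrite CG ltn_eqF.
Qed.

End UniformlyComputable.

(** * Enumeration operators all of whose axioms have singleton premises *)

Lemma pair_code_inj (x y x' y' : nat) :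
  pair_code x y = pair_code x' y' -> x = x' /\ y = y'.
Proof. by move=> /Cantor.to_nat_inj []. Qed.

Lemma seq_code_inj : injective seq_code.
Proof.
by elim=> [|x s IHs] [|y t] //= [] /pair_code_inj [-> /IHs ->].
Qed.

Definition singleton_operator (u v : nat -> nat) : nat -> Prop :=
  fun z => exists n, z = pair_code (seq_code [:: u n]) (v n).

Lemma singleton_operator_apply (u v : nat -> nat) (X : nat -> Prop) (x : nat) :
  enum_apply (singleton_operator u v) X x <-> exists2 n, X (u n) & x = v n.
Proof.
split=> [[E [EX [n /pair_code_inj [/seq_code_inj Eu ->]]]]|[n Xu ->]].
  by exists n => //; apply: EX; rewrite Eu mem_head.
exists [:: u n]; split; last by exists n.
by move=> m; rewrite inE => /eqP ->.
Qed.

(** Unbounded search for a preimage. *)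
Lemma ce_range (h : nat -> nat) :
  uniformly_computable (fun _ : unit => no_oracle) (fun=> h) ->
  ce (fun z => exists n, z = h n).
Proof.
move=> uch.
have [p pP] := uc_neg (uc_eq (uc_fst (uc_id _)) (uc_comp uch (uc_snd (uc_id _)))).
have {}pP z n : eval no_oracle p (pair_code z n) (z != h n).
  by have := pP tt (pair_code z n); rewrite pair_codeK.
exists (Mu p) => z; split=> [[n0 zn0]|[n /= [pn _]]].
  have zE : exists n, z == h n by exists n0; apply/eqP.
  case: (ex_minnP zE) => n /eqP zn nP; exists n => /=; split.
    by have := pP z n; rewrite {2}zn eqxx.
  move=> k kn; exists 0; have := pP z k; case: eqP => // /eqP zk.
  by have := nP k zk; rewrite leqNgt kn.
exists n; apply/eqP; have := eval_functional (pP z n) pn.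
by case: eqP.
Qed.

Lemma singleton_operator_ce (u v : nat -> nat) :
  uniformly_computable (fun _ : unit => no_oracle) (fun=> u) ->
  uniformly_computable (fun _ : unit => no_oracle) (fun=> v) ->
  ce (singleton_operator u v).
Proof.
move=> ucu ucv; apply: ce_range.
(* By definition, the code of [:: u n] is (pair_code (u n) 0).+1. *)
exact: uc_pair (uc_succ (uc_pair ucu (uc_const _ 0))) ucv.
Qed.

(** * Structures with nullary relations only *)

Lemma arity0_computable : computable (fun=> 0).
Proof. by exists Zero. Qed.

Definition nullary : language := Language arity0_computable.

(** The relation symbols are propositional constants, so a structure is the set
    of those which hold in it; a renaming of the universe does not affect it. *)
Definition nullary_structure (S : pred nat) : structure nullary :=
  fun i _ => S i.

Lemma nullary_isomorphism (S T : pred nat) (f : nat -> nat) :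
  isomorphism (nullary_structure S) (nullary_structure T) f -> S =1 T.
Proof.
by move=> [_ fP] i; apply/idP/idP => h; apply/(fP i [tuple]).
Qed.

Lemma atomic_diagram_nullary (S : pred nat) (n : nat) :
  atomic_diagram (nullary_structure S) n <->
  ((Cantor.of_nat n./2).2 == 0) && (S (Cantor.of_nat n./2).1 (+) odd n).
Proof.
rewrite /atomic_diagram /join; case: (odd n).
  rewrite addbT; split=> [[i [_ [-> [t [-> /negP Si]]]]]|/andP[/eqP n2 Si]].
    by rewrite tuple0 pair_codeK.
  exists (Cantor.of_nat n./2).1, 0; rewrite -n2 pair_code_of_nat; split=> //.
  by exists [tuple]; split=> //; apply/negP.
rewrite addbF; split=> [[i [_ [-> [t [-> Si]]]]]|/andP[/eqP n2 Si]].
  by rewrite tuple0 pair_codeK.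
exists (Cantor.of_nat n./2).1, 0; rewrite -n2 pair_code_of_nat; split=> //.
by exists [tuple].
Qed.

(** The position in the positive diagram of the [i]-th relation, whose only
    possible tuple is the empty one, with code 0. *)
Definition positive_code (i : nat) : nat := (pair_code i 0).*2.+1.*2.+1.

(** The diagram of the empty set holds the equality and inequality facts, which
    are common to all structures. *)
Lemma positive_diagram_nullary (S : pred nat) (n : nat) :
  positive_diagram (nullary_structure S) n <->
  positive_diagram (nullary_structure pred0) n \/
  (exists2 i, S i & n = positive_code i).
Proof.
split=> [|[|[i Si ->]]]; rewrite /positive_diagram /join.
- case: ifPn => on; last by left.
  case: ifPn => on2; last by left.
  move=> [i [c [ni [t [ct Si]]]]]; right; exists i => //.
  move: ni; rewrite ct tuple0 /= => ni.
  rewrite /positive_code -ni.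
  by move: (odd_double_half n./2) (odd_double_half n); rewrite on on2 !add1n => -> ->.
- case: ifP => // _; case: ifP => // _.
  by move=> [i [_ [_ [t [_]]]]].
rewrite /positive_code /= odd_double uphalf_double /= odd_double uphalf_double /=.
by exists i, 0; split=> //; exists [tuple].
Qed.

Lemma positive_diagram_code (S : pred nat) (i : nat) :
  positive_diagram (nullary_structure S) (positive_code i) <-> S i.
Proof.
rewrite positive_diagram_nullary; split=> [[|[k Sk]]|Si]; last by right; exists i.
  rewrite /positive_diagram /join /positive_code /=.
  rewrite odd_double uphalf_double /= odd_double uphalf_double /=.
  by move=> [k [_ [_ [t [_]]]]].
by move=> /succn_inj/double_inj/succn_inj/double_inj/pair_code_inj [-> _].
Qed.

Lemma positive_diagram_mono (S T : pred nat) (n : nat) :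
  subpred S T -> positive_diagram (nullary_structure S) n ->
  positive_diagram (nullary_structure T) n.
Proof.
move=> ST /positive_diagram_nullary [n0|[k Sk nk]].
  by apply/positive_diagram_nullary; left.
by apply/positive_diagram_nullary; right; exists k => //; apply: ST.
Qed.

(** * Morphisms and their graphs *)

Lemma hom_eq (L : language) (C : class L) (A B : obj C) (f g : Hom A B) :
  sval f = sval g -> f = g.
Proof.
case: f g => [f fP] [g gP] /= fg; rewrite -fg in gP *.
by rewrite (Classical_Prop.proof_irrelevance _ fP gP).
Qed.

Lemma graph_pair (f : nat -> nat) (x y : nat) :
  graph f (pair_code x y) <-> y = f x.
Proof. by split=> [[z /pair_code_inj [-> ->]]|->]; last exists x. Qed.

Lemma join_graph (X Y : nat -> Prop) (f : nat -> nat) (n : nat) :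
  join X (join (graph f) Y) n.*2.*2.+1 <-> graph f n.
Proof. by rewrite /join /= odd_double uphalf_double odd_double doubleK. Qed.

(** A functor that does not change the underlying functions of morphisms is
    effective on morphisms: the graph is part of the oracle, and a value of the
    function is found by searching it. *)
Lemma morphism_computable :
  exists p, forall (X Y : nat -> Prop) (f : nat -> nat),
    computes_fun p (join X (join (graph f) Y)) f.
Proof.
pose O (j : (nat -> Prop) * (nat -> Prop) * (nat -> nat)) :=
  join j.1.1 (join (graph j.2) j.1.2).
have [p pP] : uniformly_computable O (fun j => j.2).
  apply: (@uc_mu _ O (fun j n => (Cantor.of_nat n).2 == j.2 (Cantor.of_nat n).1)).
    apply: (uc_query (uc_succ (uc_double (uc_double (uc_id _))))) => j n.
    rewrite /O join_graph -{1}(pair_code_of_nat n) graph_pair.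
    by split=> /eqP.
  by move=> j x y; rewrite pair_codeK.
by exists p => X Y f; apply: (pP (X, Y, f)).
Qed.

Lemma morphism_enumerable :
  exists2 Psi, ce Psi & forall (X Y : nat -> Prop) (f : nat -> nat),
    enumerates Psi (join X (join (graph f) Y)) (graph f).
Proof.
exists (singleton_operator (fun n => n.*2.*2.+1) id).
  apply: singleton_operator_ce; last exact: uc_id.
  exact: uc_succ (uc_double (uc_double (uc_id _))).
move=> X Y f n; rewrite singleton_operator_apply.
by split=> [[m] /join_graph fm ->|fn] //; exists n => //; apply/join_graph.
Qed.

(** * Families of sets as classes of structures *)

Definition family_class (I : Type) (X : I -> pred nat) : class nullary :=
  fun A => exists i, A = nullary_structure (X i).

Definition family_obj (I : Type) (X : I -> pred nat) (i : I) :
    obj (family_class X) :=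
  exist _ (nullary_structure (X i)) (ex_intro _ i erefl).

Definition separated (I : Type) (X : I -> pred nat) : Prop :=
  forall i j, X i =1 X j -> i = j.

Definition index (I : Type) (X : I -> pred nat) (A : obj (family_class X)) : I :=
  proj1_sig (constructive_indefinite_description _ (svalP A)).

Lemma indexE (I : Type) (X : I -> pred nat) (A : obj (family_class X)) :
  sval A = nullary_structure (X (index A)).
Proof. exact: proj2_sig (constructive_indefinite_description _ (svalP A)). Qed.

Lemma nullary_structure_inj (S T : pred nat) :
  nullary_structure S = nullary_structure T -> S =1 T.
Proof.
move=> ST; apply: (@nullary_isomorphism _ _ id); rewrite ST.
exact: isomorphism_id.
Qed.

Lemma index_obj (I : Type) (X : I -> pred nat) (i : I) :
  separated X -> index (family_obj X i) = i.
Proof.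
move=> sX; apply: sX; apply: nullary_structure_inj.
by rewrite -indexE.
Qed.

(** The morphisms of the class join objects with the same index only, so any
    reindexing of one family by another is functorial. *)
Lemma Hom_index (I : Type) (X : I -> pred nat) (A B : obj (family_class X)) :
  separated X -> Hom A B -> index A = index B.
Proof.
move=> sX [f]; rewrite !indexE => /nullary_isomorphism.
exact: sX.
Qed.

Section Transfer.
Variables (I : Type) (X Y : I -> pred nat).
Hypothesis sX : separated X.

Lemma transfer_isomorphism (A B : obj (family_class X)) (f : Hom A B) :
  isomorphism (sval (family_obj Y (index A))) (sval (family_obj Y (index B)))
    (sval f).
Proof.
by rewrite (Hom_index sX f); split; first by case: (svalP f).
Qed.

Definition transfer_mor (A B : obj (family_class X)) (f : Hom A B) :
    Hom (family_obj Y (index A)) (family_obj Y (index B)) :=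
  exist _ (sval f) (transfer_isomorphism f).

Lemma transfer_id (A : obj (family_class X)) :
  transfer_mor (hom_id A) = hom_id (family_obj Y (index A)).
Proof. exact: hom_eq. Qed.

Lemma transfer_comp (A B E : obj (family_class X)) (g : Hom B E) (f : Hom A B) :
  transfer_mor (hom_comp g f) = hom_comp (transfer_mor g) (transfer_mor f).
Proof. exact: hom_eq. Qed.

Definition transfer : functor (family_class X) (family_class Y) :=
  Functor transfer_id transfer_comp.

Lemma transfer_computable :
  uniformly_computable (fun i => atomic_diagram (nullary_structure (X i)))
    (fun i n => Y i n) ->
  computable_functor transfer.
Proof.
move=> ucY.
have [p pP] := uc_and
  (uc_eq (uc_snd (uc_half (uc_id _))) (uc_const _ 0))
  (uc_xor (uc_comp ucY (uc_fst (uc_half (uc_id _)))) (uc_odd (uc_id _))).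
have [q qP] := morphism_computable.
exists p, q; split=> [A n|A B f]; last exact: qP.
have := pP (index A) n; rewrite -indexE /= atomic_diagram_nullary.
by case: (_ && _) => pn; split.
Qed.

Lemma transfer_positive_enumerable (u v : nat -> nat) :
  uniformly_computable (fun _ : unit => no_oracle) (fun=> u) ->
  uniformly_computable (fun _ : unit => no_oracle) (fun=> v) ->
  (forall i x,
    (exists2 n, positive_diagram (nullary_structure (X i)) (u n) & x = v n) <->
    positive_diagram (nullary_structure (Y i)) x) ->
  positive_enumerable_functor transfer.
Proof.
move=> ucu ucv uvP; have [Psi cePsi PsiP] := morphism_enumerable.
exists (singleton_operator u v), Psi; split=> //.
  exact: singleton_operator_ce.
by move=> A x; rewrite singleton_operator_apply indexE.
Qed.

End Transfer.

(** The round trip gives back the same structure, so the natural isomorphisms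
    of a pseudo inverse can be taken to be identities. *)
Lemma transfer_back_and_forth (I : Type) (X Y : I -> pred nat)
    (sX : separated X) (sY : separated Y) (A : obj (family_class X)) :
  isomorphism (sval A) (sval (fobj (transfer X sY) (fobj (transfer Y sX) A))) id.
Proof. by rewrite /= index_obj // -indexE; apply: isomorphism_id. Qed.

Lemma transfer_pseudo_inverses (I : Type) (X Y : I -> pred nat)
    (sX : separated X) (sY : separated Y) :
  pseudo_inverses (transfer Y sX) (transfer X sY).
Proof.
have [p pP] := uc_id (fun O : nat -> Prop => O).
exists p, p, (fun A => exist _ id (transfer_back_and_forth sX sY A)),
  (fun B => exist _ id (transfer_back_and_forth sY sX B)).
split.
- by split=> [A|A B h]; [apply: pP|apply: hom_eq].
- by split=> [A|A B h]; [apply: pP|apply: hom_eq].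
- by move=> A; apply: hom_eq.
by move=> B; apply: hom_eq.
Qed.

Lemma family_uct_reducible (I : Type) (X Y : I -> pred nat) :
  separated X -> separated Y ->
  uniformly_computable (fun i => atomic_diagram (nullary_structure (X i)))
    (fun i n => Y i n) ->
  uniformly_computable (fun i => atomic_diagram (nullary_structure (Y i)))
    (fun i n => X i n) ->
  uct_reducible (family_class X) (family_class Y).
Proof.
move=> sX sY XY YX; exists (family_class Y); split=> //.
exists (transfer Y sX), (transfer X sY); split; try exact: transfer_computable.
exact: transfer_pseudo_inverses.
Qed.

(** If F sends two objects to one structure, then G sends these images to
    isomorphic objects, which are in turn isomorphic to the two given ones. *)
Lemma pseudo_inverses_injective (I : Type) (X : I -> pred nat) (M : language)
    (D : class M) (F : functor (family_class X) D) (G : functor D (family_class X))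
    (i j : I) :
  separated X -> pseudo_inverses F G ->
  sval (fobj F (family_obj X i)) = sval (fobj F (family_obj X j)) -> i = j.
Proof.
move=> sX [_ [_ [lam _]]] Fij.
have idP : isomorphism (sval (fobj F (family_obj X i)))
                       (sval (fobj F (family_obj X j))) id.
  by rewrite Fij; apply: isomorphism_id.
pose h : Hom (fobj F (family_obj X i)) (fobj F (family_obj X j)) := exist _ id idP.
rewrite -(index_obj i sX) -(index_obj j sX).
rewrite (Hom_index sX (lam (family_obj X j))).
exact: Hom_index sX (hom_comp (fmor G h) (lam (family_obj X i))).
Qed.

(** * Monotonicity and continuity of reductions *)

Lemma enum_apply_mono (Psi X Y : nat -> Prop) :
  (forall n, X n -> Y n) -> forall x, enum_apply Psi X x -> enum_apply Psi Y x.
Proof. by move=> XY x [E [EX Px]]; exists E; split=> // n /EX /XY. Qed.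

(** The inclusion order of the sets is that of the positive diagrams, since only
    relations that hold are listed there. *)
Lemma upet_reducible_monotone (I K : Type) (X : I -> pred nat) (Y : K -> pred nat) :
  separated X -> upet_reducible (family_class X) (family_class Y) ->
  exists k : I -> K,
    injective k /\ forall i j, subpred (X i) (X j) -> subpred (Y (k i)) (Y (k j)).
Proof.
move=> sX [D' [sub [F [G [[Psi [_ [_ _ PsiP _]]] _ FG]]]]].
pose B i : obj (family_class Y) := exist _ (sval (fobj F (family_obj X i)))
  (sub _ (svalP (fobj F (family_obj X i)))).
exists (fun i => index (B i)); split=> [i j kij|i j Xij n].
  apply: (pseudo_inverses_injective sX FG).
  by rewrite -[LHS]/(sval (B i)) -[RHS]/(sval (B j)) !indexE kij.
rewrite -!positive_diagram_code -!indexE /= -!PsiP; apply: enum_apply_mono => m.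
exact: positive_diagram_mono.
Qed.

(** The use principle: a halting computation asks finitely many queries. *)
Lemma eval_use (X : nat -> Prop) (p : program) (x y : nat) :
  eval X p x y ->
  exists N, forall Y : nat -> Prop,
    (forall n, n < N -> X n <-> Y n) -> eval Y p x y.
Proof.
(* Finitely many computations have a common bound on their uses. *)
have bound (n : nat) (P : nat -> (nat -> Prop) -> Prop) :
    (forall k, k < n -> exists N, forall Y : nat -> Prop,
      (forall m, m < N -> X m <-> Y m) -> P k Y) ->
    exists N, forall Y : nat -> Prop,
      (forall m, m < N -> X m <-> Y m) -> forall k, k < n -> P k Y.
  elim: n => [|n IHn] h; first by exists 0.
  have [N1 N1P] := IHn (fun k kn => h k (ltnW kn)).
  have [N2 N2P] := h n (ltnSn n).
  exists (maxn N1 N2) => Y XY k; rewrite ltnS leq_eqVlt => /orP[/eqP ->|kn].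
    by apply: N2P => m mN; apply: XY; rewrite leq_max mN orbT.
  by apply: N1P => // m mN; apply: XY; rewrite leq_max mN.
have maxl N1 N2 (Y : nat -> Prop) :
    (forall m, m < maxn N1 N2 -> X m <-> Y m) -> forall m, m < N1 -> X m <-> Y m.
  by move=> XY m mN; apply: XY; rewrite leq_max mN.
have maxr N1 N2 (Y : nat -> Prop) :
    (forall m, m < maxn N1 N2 -> X m <-> Y m) -> forall m, m < N2 -> X m <-> Y m.
  by rewrite maxnC; apply: maxl.
elim: p x y => [||||p IHp q IHq|p IHp q IHq|p IHp q IHq|p IHp|] x y /=;
  try by exists 0.
- move=> [a [b [/IHp [N1 N1P] /IHq [N2 N2P] ->]]].
  exists (maxn N1 N2) => Y XY; exists a, b; split=> //.
    exact: N1P (maxl _ _ _ XY).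
  exact: N2P (maxr _ _ _ XY).
- move=> [z /IHq [N1 N1P] /IHp [N2 N2P]].
  exists (maxn N1 N2) => Y XY; exists z.
    exact: N1P (maxl _ _ _ XY).
  exact: N2P (maxr _ _ _ XY).
- case: (Cantor.of_nat x) => a n [v [/IHp [N1 N1P] vS ->]].
  have [N2 N2P] := bound n
    (fun k Y => eval Y q (pair_code a (pair_code k (v k))) (v k.+1))
    (fun k kn => IHq _ _ (vS k kn)).
  exists (maxn N1 N2) => Y XY; exists v; split=> //.
    exact: N1P (maxl _ _ _ XY).
  exact: N2P (maxr _ _ _ XY).
- move=> [/IHp [N1 N1P] yP].
  have [N2 N2P] := bound y
    (fun k Y => exists v, eval Y p (pair_code x k) v.+1)
    (fun k ky => let: ex_intro v pv := yP k ky in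
                 let: ex_intro N NP := IHp _ _ pv in
                 ex_intro _ N (fun Y XY => ex_intro _ v (NP Y XY))).
  exists (maxn N1 N2) => Y XY; split.
    exact: N1P (maxl _ _ _ XY).
  exact: N2P (maxr _ _ _ XY).
move=> Xx; exists x.+1 => Y /(_ x (ltnSn x)) XY.
by case: Xx => -[Xx ->]; [left|right]; split=> //; [apply/XY|move=> /XY].
Qed.

Lemma leq_pair_code (x y : nat) : x <= pair_code x y.
Proof.
apply: leq_trans (leq_addl y x) _.
by apply/leP; apply: Cantor.to_nat_non_decreasing.
Qed.

(** Two sets that agree below N have atomic diagrams that agree below N, since
    the code of a fact about the relation i is at least i; so the use of one
    computation bounds how far the sets need to agree. *)
Lemma uct_reducible_continuous (I K : Type) (X : I -> pred nat) (Y : K -> pred nat) :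
  separated X -> uct_reducible (family_class X) (family_class Y) ->
  exists k : I -> K,
    injective k /\ forall i m, exists N, forall j,
      (forall n, n < N -> X i n = X j n) -> Y (k i) m = Y (k j) m.
Proof.
move=> sX [D' [sub [F [G [[Phi [_ [PhiP _]]] _ FG]]]]].
pose B i : obj (family_class Y) := exist _ (sval (fobj F (family_obj X i)))
  (sub _ (svalP (fobj F (family_obj X i)))).
exists (fun i => index (B i)); split=> [i j kij|i m].
  apply: (pseudo_inverses_injective sX FG).
  by rewrite -[LHS]/(sval (B i)) -[RHS]/(sval (B j)) !indexE kij.
have {}PhiP j : eval (atomic_diagram (nullary_structure (X j))) Phi
    (pair_code m 0).*2 (Y (index (B j)) m).
  have := PhiP (family_obj X j) (pair_code m 0).*2.
  rewrite -[sval (fobj _ _)]/(sval (B j)) [sval (B j)]indexE.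
  rewrite atomic_diagram_nullary doubleK pair_codeK odd_double addbF /=.
  by case: (Y _ m) => -[h1 h0]; [apply: h1|apply: h0].
(* The use of the computation that decides whether m belongs to the image. *)
have [N NP] := eval_use (PhiP i); exists N => j Xij.
have /NP ij : forall n, n < N ->
    atomic_diagram (nullary_structure (X i)) n <->
    atomic_diagram (nullary_structure (X j)) n.
  move=> n nN; rewrite !atomic_diagram_nullary Xij //.
  apply: leq_ltn_trans nN; apply: (@leq_trans n./2).
    by rewrite -{2}(pair_code_of_nat n./2) leq_pair_code.
  by rewrite -{2}(odd_double_half n) -addnn addnA leq_addl.
have := eval_functional ij (PhiP j).
by case: (Y _ _); case: (Y _ _).
Qed.

(** * A chain and an antichain *)

Definition chain (b : bool) : pred nat := fun n => b && (n == 0).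

Definition antichain (b : bool) : pred nat := fun n => n == ~~ b.

Lemma chain_separated : separated chain.
Proof. by move=> [] [] // /(_ 0). Qed.

Lemma antichain_separated : separated antichain.
Proof. by move=> [] [] // /(_ 0). Qed.

Lemma atomic_diagram0 (S : pred nat) :
  atomic_diagram (nullary_structure S) 0 <-> S 0.
Proof. by rewrite atomic_diagram_nullary /= addbF. Qed.

Lemma chain_uct_reducible :
  uct_reducible (family_class chain) (family_class antichain).
Proof.
have query0 (X : bool -> pred nat) : (forall b, X b 0 = b) ->
    uniformly_computable (fun b => atomic_diagram (nullary_structure (X b)))
      (fun b _ => b).
  move=> X0; apply: (uc_query (uc_const _ 0)) => b _.
  by rewrite atomic_diagram0 X0.
apply: family_uct_reducible.
- exact: chain_separated.
- exact: antichain_separated.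
- (* In both families, the relation 0 holds in the member [true] only. *)
  by apply: uc_eq (uc_id _) _; apply: uc_neg; apply: query0; case.
apply: uc_and; first by apply: query0; case.
exact: uc_eq (uc_id _) (uc_const _ 0).
Qed.

Lemma chain_not_upet_reducible :
  ~ upet_reducible (family_class chain) (family_class antichain).
Proof.
move=> /(upet_reducible_monotone chain_separated) [k [kinj kmono]].
have sub : subpred (antichain (k false)) (antichain (k true)) by apply: kmono.
have /eqP kE : (~~ k false : nat) == ~~ k true by apply: sub; rewrite /antichain.
(* Comparable members of an antichain are equal. *)
suff /kinj : k false = k true by [].
by move: kE; case: (k false); case: (k true).
Qed.

(** * A convergent sequence and a discrete family *)

Definition convergent (o : option nat) : pred nat :=
  fun n => if o is Some m then n == m.+1 else false.

Definition discrete (o : option nat) : pred nat :=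
  fun n => if o is Some m then (n == 0) || (n == m.+1) else false.

Lemma convergent_separated : separated convergent.
Proof.
move=> [m|] [m'|] // eqS.
- by have := eqS m.+1; rewrite /= eqxx => /esym/eqP [->].
- by have := eqS m.+1; rewrite /= eqxx.
by have := eqS m'.+1; rewrite /= eqxx.
Qed.

(** The number m+1 belongs to {0, m+1} only, and 0 to every member but {}. *)
Lemma discrete_isolated (o : option nat) :
  exists n, forall o', discrete o' n = discrete o n -> o' = o.
Proof.
case: o => [m|]; last by exists 0; case.
by exists m.+1 => -[m'|] /=; rewrite eqxx //= => /eqP [->].
Qed.

Lemma discrete_separated : separated discrete.
Proof. by move=> i j ij; have [n] := discrete_isolated j; apply; apply: ij. Qed.

Lemma sub_convergent_discrete (o : option nat) :
  subpred (convergent o) (discrete o).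
Proof. by case: o => [m|] // n /= ->; rewrite orbT. Qed.

Lemma uc_positive_code (J : Type) (O : J -> nat -> Prop) (G : J -> nat -> nat) :
  uniformly_computable O G ->
  uniformly_computable O (fun j n => positive_code (G j n)).
Proof.
move=> ucG.
exact: uc_succ (uc_double (uc_succ (uc_double (uc_pair ucG (uc_const _ 0))))).
Qed.

Lemma convergent_upet_reducible :
  upet_reducible (family_class convergent) (family_class discrete).
Proof.
exists (family_class discrete); split=> //.
exists (transfer discrete convergent_separated),
  (transfer convergent discrete_separated).
split; last exact: transfer_pseudo_inverses.
- (* Input [pair_code 0 m] copies m; input [pair_code c m] with c > 0 puts the
     relation 0 in because the relation m holds. *)
  pose b n := (Cantor.of_nat n).1 == 0.
  pose m n := (Cantor.of_nat n).2.
  have ucb : uniformly_computable (fun _ : unit => no_oracle) (fun _ n => b n).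
    exact: uc_eq (uc_fst (uc_id _)) (uc_const _ 0).
  have ucm := uc_snd (uc_id (fun _ : unit => no_oracle)).
  apply: (@transfer_positive_enumerable _ _ _ _
    (fun n => if b n then m n else positive_code (m n))
    (fun n => if b n then m n else positive_code 0)).
  + exact: uc_if ucb ucm (uc_positive_code ucm).
  + exact: uc_if ucb ucm (uc_positive_code (uc_const _ 0)).
  move=> o x; split=> [[n]|].
    case: (b n) => [Xm ->|/positive_diagram_code om ->].
      exact: positive_diagram_mono (@sub_convergent_discrete o) Xm.
    by apply/positive_diagram_code; case: o om.
  have b0 y : b (pair_code 0 y) by rewrite /b pair_codeK.
  have mE i y : m (pair_code i y) = y by rewrite /m pair_codeK.
  have P0 : positive_diagram (nullary_structure (convergent o)) x ->
      exists2 n, positive_diagram (nullary_structure (convergent o))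
        (if b n then m n else positive_code (m n))
        & x = if b n then m n else positive_code 0.
    by exists (pair_code 0 x); rewrite b0 mE.
  rewrite positive_diagram_nullary => -[x0|[i oi xi]].
    by apply: P0; apply/positive_diagram_nullary; left.
  case: o oi P0 => [k|] //= /orP[/eqP i0|ik] P0.
    have b1 y : b (pair_code 1 y) = false by rewrite /b pair_codeK.
    exists (pair_code 1 k.+1); rewrite b1 ?mE ?xi ?i0 //.
    by apply/positive_diagram_code => /=.
  by apply: P0; rewrite xi; apply/positive_diagram_code.
(* Copy everything but the relation 0; the value 0 codes the fact 0 = 0, which
   is in every positive diagram. *)
pose u n := if n == positive_code 0 then 0 else n.
have ucu : uniformly_computable (fun _ : unit => no_oracle) (fun=> u).
  exact: uc_if (uc_eq (uc_id _) (uc_const _ _)) (uc_const _ 0) (uc_id _).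
apply: (transfer_positive_enumerable _ ucu ucu) => o x; split=> [[n + ->]|Px].
  rewrite /u; case: eqP => [_ _|n0]; first by exists 0, 0.
  rewrite positive_diagram_nullary => -[?|[i oi ni]].
    by apply/positive_diagram_nullary; left.
  rewrite ni; apply/positive_diagram_code.
  case: o oi => //= k /orP[/eqP i0|//].
  by case: n0; rewrite ni i0.
have ux : u x = x.
  rewrite /u; case: eqP => // x0; move: Px; rewrite x0 positive_diagram_code.
  by case: (o).
exists x; rewrite ux //.
exact: positive_diagram_mono (@sub_convergent_discrete o) Px.
Qed.

Lemma convergent_not_uct_reducible :
  ~ uct_reducible (family_class convergent) (family_class discrete).
Proof.
move=> /(uct_reducible_continuous convergent_separated) [k [kinj kcont]].
have [m mP] := discrete_isolated (k None).
(* Near the empty set, the map k is constant. *)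
have [N NP] := kcont None m.
suff /kinj : k (Some N) = k None by [].
apply: mP; apply/esym; apply: NP => n nN /=.
by rewrite ltn_eqF // ltnS ltnW.
Qed.

Theorem corollary26 :
  exists (L1 M1 L2 M2 : language)
         (C1 : class L1) (D1 : class M1) (C2 : class L2) (D2 : class M2),
    (uct_reducible C1 D1 /\ ~ upet_reducible C1 D1) /\
    (upet_reducible C2 D2 /\ ~ uct_reducible C2 D2).
Proof.
exists nullary, nullary, nullary, nullary.
exists (family_class chain), (family_class antichain).
exists (family_class convergent), (family_class discrete).
split; split.
- exact: chain_uct_reducible.
- exact: chain_not_upet_reducible.
- exact: convergent_upet_reducible.
exact: convergent_not_uct_reducible.
Qed.
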